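(* For $n\ge1$ let $E_n=A(2n-1,n)$ be the central Eulerian number. Then $$E_n\equiv\begin{cases}1\pmod 3&\text{if } n\in T(01)+1,\\ 0\pmod 3&\text{otherwise.}\end{cases}$$
   Context: The Eulerian number $A(n,k)$ is the number of permutations of $\{1,\ldots,n\}$ with exactly $k-1$ descents; equivalently $A(n,k)=\sum_{i=0}^{k}(-1)^i(k-i)^n\binom{n+1}{i}$. $T(01)$ denotes the set of $m\in\mathbb{N}$ whose base-$3$ expansion contains only digits $0$ and $1$, and $T(01)+1=\{m+1: m\in T(01)\}$. *)

(* Defs.v *)
From mathcomp Require Import all_boot all_fingroup.

Set Implicit Arguments.
Unset Strict Implicit.
Unset Printing Implicit Defensive.

(* Positions and values are numbered from 0: 'I_n plays the role of           *)
(* {1, ..., n}. Position i is a descent when its successor j exists and       *)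
(* carries a smaller value.                                                   *)
Definition descents (n : nat) (s : 'S_n) : {set 'I_n} :=
  [set i : 'I_n | [exists j : 'I_n, (val j == i.+1) && (s j < s i)]].

(* "k - 1 descents" is stated as #|descents s|.+1 = k, so that the count is 0 *)
(* for k = 0.                                                                 *)
Definition eulerian (n k : nat) : nat :=
  #|[set s : 'S_n | #|descents s|.+1 == k]|.

Definition central_eulerian (n : nat) : nat := eulerian (2 * n - 1) n.

Definition digit (b m i : nat) : nat := (m %/ b ^ i) %% b.

(* Positions beyond the leading digit hold 0, which is allowed, so            *)
(* quantifying over all i is harmless; in particular T01 0 holds.             *)
Definition T01 (m : nat) : Prop := forall i : nat, digit 3 m i \in [:: 0; 1].

Definition T01_plus1 (n : nat) : Prop := exists2 m : nat, T01 m & n = m + 1.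

(* Main.v *)
(** Let [A_n] be the generating polynomial of permutations of [n] letters by
    number of descents. Inserting the maximum into a permutation of [n] letters
    gives [A_{n+1} = (1 + n X) A_n + X (1 - X) A_n']. Modulo 3 the recurrence is
    solved by [A_{2m+1} = (1 - X)^(2m)] and [A_{2m+2} = (1 + X) (1 - X)^(2m)],
    so [E_{m+1}] is congruent to the coefficient [c_m] of [X^m] in [(1 - X)^(2m)].
    Since [(1 - X)^3 = 1 - X^3] modulo 3, this coefficient satisfies
    [c_{3q} = c_{3q+1} = c_q] and [c_{3q+2} = 0]. *)

Require Import Defs.
From mathcomp Require Import all_boot all_fingroup.
From mathcomp Require Import all_algebra.
From mathcomp Require Import zify ring.

Import GRing.Theory.

(** Digit [i.+1] of [m] is digit [i] of [m %/ 3]; peeling off the lowest digit drives the induction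
    in [central_coefP]. *)
Lemma T01E (m : nat) : T01 m <-> m %% 3 != 2 /\ T01 (m %/ 3).
Proof.
have digitS i : digit 3 m i.+1 = digit 3 (m %/ 3) i.
  by rewrite /digit expnS divnMA.
split=> [Tm | [m2 Tm] [|i]].
- split=> [|i]; last by rewrite -digitS.
  have := Tm 0; rewrite /digit expn0 divn1 !inE.
  by case/orP=> /eqP ->.
- rewrite /digit expn0 divn1 !inE.
  by move: m2 (ltn_pmod m (isT : 0 < 3)); case: (m %% 3) => [|[|[|]]].
- by rewrite digitS.
Qed.

Lemma descent_succ_lt (n : nat) (s : 'S_n) (k : 'I_n) :
  k \in descents s -> k.+1 < n.
Proof. by rewrite inE => /existsP[j /andP[/eqP <- _]]; apply: ltn_ord. Qed.

Lemma card_descents_le (n : nat) (s : 'S_n) : #|descents s| <= n.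
Proof. by rewrite -[leqRHS]card_ord max_card. Qed.

Section InsertMax.

Variables (n : nat) (s : 'S_n).

(** [lift i] renumbers the old positions. A descent at [k] is lost only when the maximum lands just
    after [k], turning that step into an ascent. *)
Lemma lift_perm_max_descent (i : 'I_n.+1) (k : 'I_n) :
  (lift i k \in descents (lift_perm i ord_max s)) =
    (k \in descents s) && (k.+1 != i).
Proof.
rewrite !inE; apply/existsP/andP=> [[q]|[/existsP[l /andP[/eqP lk slk]] ki]].
  case: (unliftP i q) => [l ->|->]; last first.
    rewrite lift_perm_id lift_perm_lift lift_max /= => /andP[_].
    by rewrite ltnNge ltnW // ltn_ord.
  rewrite !lift_perm_lift !lift_max /= => /andP[/eqP lk slk].
  have [lk' ki] : l = k.+1 :> nat /\ k.+1 != i.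
    by move: (l : nat) (k : nat) (i : nat) lk; rewrite /bump; lia.
  by split=> //; apply/existsP; exists l; rewrite lk' eqxx.
exists (lift i l); rewrite !lift_perm_lift !lift_max slk andbT /=.
by move: lk ki; rewrite /bump /=; lia.
Qed.

Lemma lift_perm_max_descent_id (i : 'I_n.+1) :
  (i \in descents (lift_perm i ord_max s)) = (i < n).
Proof.
rewrite inE; apply/existsP/idP=> [[q /andP[/eqP qi _]]|lt_in].
  by rewrite -ltnS -qi ltn_ord.
have lt_Si : i.+1 < n.+1 by [].
exists (Ordinal lt_Si); rewrite eqxx lift_perm_id /=.
case: (unliftP i (Ordinal lt_Si)) => [l ->|/(congr1 val) /= ].
  by rewrite lift_perm_lift lift_max /= ltn_ord.
by move/esym/n_Sn.
Qed.

(* The gaps (identified with the position of the maximum after insertion)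
   where inserting the maximum creates no descent: the end of the word, and
   the gap inside each descent. *)
Definition neutral_gaps : {set 'I_n.+1} :=
  ord_max |: [set lift ord0 k | k in descents s].

Lemma card_neutral_gaps : #|neutral_gaps| = #|descents s|.+1.
Proof.
rewrite cardsU1 card_imset; last exact: lift_inj.
case: imsetP => // -[k /descent_succ_lt lt_kn /(congr1 val) /=].
by rewrite /bump leq0n add1n => e; rewrite -e ltnn in lt_kn.
Qed.

(** Anywhere but at the end, the maximum starts one new descent; it destroys an old one exactly when
    inserted inside it. *)
Lemma card_descents_lift_perm_max (i : 'I_n.+1) :
  #|descents (lift_perm i ord_max s)| = #|descents s| + (i \notin neutral_gaps).
Proof.
have -> : #|descents (lift_perm i ord_max s)| =
    (i < n) + #|[set k in descents s | k.+1 != i]|.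
  rewrite (cardsD1 i) lift_perm_max_descent_id; congr (_ + _).
  rewrite -(card_imset _ (@lift_inj _ i)); congr #|pred_of_set _|.
  apply/setP=> p; rewrite in_setD1.
  case: (unliftP i p) => [k ->|->].
    rewrite eq_sym neq_lift lift_perm_max_descent mem_imset ?inE //.
    exact: lift_inj.
  rewrite eqxx; apply/esym/imsetP=> -[k _ /eqP].
  by rewrite (negPf (neq_lift i k)).
rewrite /neutral_gaps in_setU1 negb_or.
have [->|i_max] := eqVneq i ord_max.
  rewrite /= ltnn addn0; apply: eq_card => k; rewrite inE.
  by case: (boolP (k \in _)) => //= /descent_succ_lt; lia.
have lt_in : i < n.
  rewrite ltn_neqAle -ltnS ltn_ord andbT.
  by apply: contra i_max => /eqP e; apply/eqP/val_inj.
rewrite lt_in; case: imsetP => [[k kD ->]|ki] /=.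
  rewrite addn0 (cardsD1 k (descents s)) kD; congr (_ + _).
  by apply: eq_card => l; rewrite !inE andbC /bump /= add1n eqSS.
rewrite addnC; congr (_ + _); apply: eq_card => k; rewrite inE.
case: (boolP (k \in _)) => //= kD; apply/eqP=> e; apply: ki.
by exists k => //; apply: val_inj.
Qed.

End InsertMax.

Arguments neutral_gaps {n} s.

Local Open Scope ring_scope.

Lemma size_1subX_exp (R : nzRingType) (k : nat) :
  (size ((1 - 'X : {poly R}) ^+ k)%R <= k.+1)%N.
Proof.
apply: leq_trans (size_poly_exp_leq _ _) _.
by rewrite -opprB size_polyN size_XsubC mul1n.
Qed.

(** Exponents in [p \Po 'X^n] are multiples of [n] and those in [q] are below [n], so by Euclidean
    division only one product reaches [n * d + c]. *)
Lemma coef_comp_poly_XnM (R : nzRingType) (p q : {poly R}) (n d c : nat) :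
  (c < n)%N -> (size q <= n)%N ->
  ((p \Po 'X^n) * q)`_(n * d + c) = p`_d * q`_c.
Proof.
move=> lt_cn le_qn; have n_gt0 : (0 < n)%N by apply: leq_ltn_trans lt_cn.
have lt_c : (c < (n * d + c).+1)%N by rewrite ltnS leq_addl.
rewrite coefMr (bigD1 (Ordinal lt_c)) //= big1 => [|j j_c].
  by rewrite addr0 addnK coef_comp_poly_Xn // dvdn_mulr // mulKn.
have [le_nj|lt_jn] := leqP n j.
  by rewrite [q`_j]nth_default ?mulr0 // (leq_trans le_qn).
have le_j : (j <= n * d + c)%N by rewrite -ltnS.
rewrite coef_comp_poly_Xn // ifN ?mul0r // -eqn_mod_dvd //.
have := modnMDl d c n; rewrite [(d * n)%N]mulnC => ->; rewrite !modn_small //.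
by apply: contra j_c => /eqP e; apply/eqP/val_inj.
Qed.

Section EulerianPoly.

Variable R : comNzRingType.

Definition eulerian_poly (n : nat) : {poly R} :=
  \sum_(s : 'S_n) 'X^#|descents s|.

Lemma coef_eulerian_poly (n k : nat) :
  (eulerian_poly n)`_k = (eulerian n k.+1)%:R.
Proof.
rewrite coef_sum /eulerian -sum1_card natr_sum [RHS]big_mkcond /=.
by apply: eq_bigr => s _; rewrite coefXn inE eqSS eq_sym; case: eqP.
Qed.

(** The gap is recovered as the position of the maximum, which gives injectivity; the cardinals
    agree. *)
Lemma lift_perm_max_bij (n : nat) :
  bijective (fun p : 'I_n.+1 * 'S_n => lift_perm p.1 ord_max p.2).
Proof.
apply: inj_card_bij => [[i s] [j t] /= e|]; last first.
  by rewrite card_prod card_ord !card_Sn factS.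
have eij : i = j.
  by apply: (@perm_inj _ (lift_perm i ord_max s)); rewrite {2}e !lift_perm_id.
rewrite -{}eij in e *; congr (_, _); apply/permP=> k.
by apply: (@lift_inj _ ord_max); rewrite -!(lift_perm_lift i) e.
Qed.

(** Of the [n.+1] gaps of a permutation with [d] descents, [d.+1] keep [d] and [n - d] raise it by
    one, contributing [(d + 1) X^d + (n - d) X^(d+1)]. *)
Lemma eulerian_polyS (n : nat) :
  eulerian_poly n.+1 =
    (1 + n%:R * 'X) * eulerian_poly n + 'X * (1 - 'X) * (eulerian_poly n)^`().
Proof.
rewrite {1}/eulerian_poly (reindex _ (onW_bij _ (lift_perm_max_bij n))).
rewrite -(pair_bigA _ (fun i s => 'X^#|descents (lift_perm i ord_max s)|)) /=.
rewrite exchange_big raddf_sum !mulr_sumr -big_split /=.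
apply: eq_bigr => s _; set d := #|descents s|.
rewrite (bigID (mem (neutral_gaps s))) /=.
rewrite (eq_bigr (fun=> 'X^d)); last first.
  by move=> i iG; rewrite card_descents_lift_perm_max iG addn0.
rewrite [X in _ + X](eq_bigr (fun=> 'X^(d.+1))); last first.
  by move=> i iG; rewrite card_descents_lift_perm_max iG addn1.
rewrite !sumr_const card_neutral_gaps -/d.
have -> : #|[pred i | i \notin neutral_gaps s]| = (n - d)%N.
  have := cardC (neutral_gaps s); rewrite card_ord card_neutral_gaps -/d.
  by rewrite addSn => -[dE]; rewrite -[in RHS]dE addKn.
have le_dn : (d <= n)%N by apply: card_descents_le.
rewrite -(mulr_natr _ d.+1) -(mulr_natr _ (n - d)) natrB // derivXn exprS.
(* For [d = 0] the truncated exponent [d.-1] is harmless: the factor [d] vanishes. *)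
have -> : 'X * (1 - 'X) * ('X^(d.-1) *+ d) = (1 - 'X) * 'X^d * d%:R :> {poly R}.
  by case: (d) => [|e]; rewrite ?mulr0 // -mulr_natr exprS; ring.
by rewrite -natr1; ring.
Qed.

Lemma eulerian_poly0 : eulerian_poly 0 = 1.
Proof.
rewrite /eulerian_poly (eq_bigr (fun=> 1)) => [|s _].
  by rewrite sumr_const card_Sn.
by have := card_descents_le _ s; rewrite leqn0 => /eqP ->.
Qed.

Lemma deriv_expr_1subX (k : nat) :
  (1 - 'X) * ((1 - 'X) ^+ k)^`() = - k%:R * (1 - 'X) ^+ k :> {poly R}.
Proof.
rewrite deriv_exp derivB derivX derivC -mulr_natr.
by case: k => [|k]; rewrite ?exprS /=; ring.
Qed.

Hypothesis R3 : 3%:R = 0 :> R.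

Let poly3 : 3%:R = 0 :> {poly R}.
Proof. by rewrite -polyC_natr R3. Qed.

Lemma eulerian_poly_odd_mod3 (m : nat) :
  eulerian_poly m.*2.+1 = (1 - 'X) ^+ m.*2.
Proof.
elim: m => [|m IHm].
  by rewrite eulerian_polyS eulerian_poly0 derivE double0 expr0; ring.
set B : {poly R} := (1 - 'X) ^+ m.*2.
(* Given the induction hypothesis this step is exact: the terms in [m] cancel without reduction
   modulo 3. *)
have even : eulerian_poly m.*2.+2 = (1 + 'X) * B.
  rewrite eulerian_polyS IHm -mulrA deriv_expr_1subX -/B -natr1.
  by ring.
rewrite doubleS eulerian_polyS even derivM -mulrA mulrDr.
rewrite (mulrCA (1 - 'X) (1 + 'X)) deriv_expr_1subX -/B.
rewrite derivD derivX derivC -!natr1 exprSr exprSr -/B.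
(* The recurrence yields [(1 + 4 X + X^2) B], which is [((1 - X)^2 + 6 X) B]. *)
transitivity (B * (1 - 'X) * (1 - 'X) + 3%:R * (2%:R * 'X * B)); first by ring.
by rewrite poly3; ring.
Qed.

Definition central_coef (m : nat) : R := ((1 - 'X) ^+ m.*2)`_m.

Lemma cube_1subX : (1 - 'X) ^+ 3 = (1 - 'X) \Po 'X^3 :> {poly R}.
Proof.
rewrite comp_polyB comp_polyX comp_polyC.
transitivity (1 - 'X^3 + 3%:R * ('X^2 - 'X) : {poly R}); first by ring.
by rewrite poly3; ring.
Qed.

(** Doubling gives exponents [3 (2q)], [3 (2q) + 2] and [3 (2q + 1) + 1]. At [X^r] the leftover
    factors [1], [(1 - X)^2] and [1 - X] have coefficients [1], [-2 = 1] and [0]. *)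
Lemma central_coef_mod3 (q r : nat) : (r < 3)%N ->
  central_coef (3 * q + r) = if r == 2%N then 0 else central_coef q.
Proof.
(* A Lucas-type splitting, from [(1 - X)^(3a+b) = (1 - X^3)^a (1 - X)^b]. *)
have split a b d c : (b < 3)%N -> (c < 3)%N ->
    ((1 - 'X) ^+ (3 * a + b))`_(3 * d + c) =
      ((1 - 'X) ^+ a)`_d * ((1 - 'X) ^+ b)`_c :> R.
  move=> b3 c3; rewrite exprD exprM cube_1subX -rmorphXn /=.
  by rewrite coef_comp_poly_XnM // (leq_trans (size_1subX_exp _ _)).
rewrite /central_coef; case: r => [|[|[|//]]] _ /=.
- have -> : (3 * q + 0).*2 = (3 * q.*2 + 0)%N by lia.
  by rewrite split // expr0 coef1 mulr1.
- have -> : (3 * q + 1).*2 = (3 * q.*2 + 2)%N by lia.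
  rewrite split // (_ : (1 - 'X) ^+ 2 = 1 - 2%:R *: 'X + 'X^2); last first.
    by rewrite scaler_nat; ring.
  rewrite coefD coefB coef1 coefZ coefX coefXn /= sub0r addr0 mulr1.
  have -> : - 2%:R = 1 :> R by rewrite -[RHS]subr0 -R3; ring.
  by rewrite mulr1.
- have -> : (3 * q + 2).*2 = (3 * q.*2.+1 + 1)%N by lia.
  by rewrite split // expr1 coefB coef1 coefX subr0 mulr0.
Qed.

Lemma central_coefP (m : nat) :
  (T01 m -> central_coef m = 1) /\ (~ T01 m -> central_coef m = 0).
Proof.
elim/ltn_ind: m => m IHm.
(* Zero is apart because [m %/ 3 < m] needs [m] positive. *)
have [->|m_gt0] := posnP m.
  split=> [_|[]]; first by rewrite /central_coef expr0 coef1.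
  by move=> i; rewrite /digit div0n.
have [IH1 IH0] := IHm _ (ltn_Pdiv (isT : 1 < 3)%N m_gt0).
have := T01E m; have -> : central_coef m =
    if (m %% 3 == 2)%N then 0 else central_coef (m %/ 3).
  by rewrite -central_coef_mod3 ?ltn_pmod // mulnC -divn_eq.
case: eqP => /= [_|_] E; split=> T.
- by case/E: T.
- by [].
- by case/E: T => _ /IH1.
- by apply: IH0 => T'; apply/T/E.
Qed.

End EulerianPoly.

Local Close Scope ring_scope.

Theorem theorem5p9 (n : nat) (hn : 1 <= n) :
  (T01_plus1 n -> central_eulerian n = 1 %[mod 3]) /\
  (~ T01_plus1 n -> central_eulerian n = 0 %[mod 3]).
Proof.
case: n hn => [//|m] _.
have F3 : (3%:R = 0 :> 'F_3)%R by apply/val_inj.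
have E : ((central_eulerian m.+1)%:R = central_coef 'F_3 m)%R.
  rewrite /central_eulerian -coef_eulerian_poly.
  have -> : 2 * m.+1 - 1 = m.*2.+1 by lia.
  by rewrite eulerian_poly_odd_mod3.
have TE : T01_plus1 m.+1 <-> T01 m.
  split=> [[k Tk]|Tm]; last by exists m; rewrite ?addn1.
  by rewrite addn1 => -[->].
(* The representative of a natural number in ['F_3] is its remainder modulo 3. *)
have modE k : ((central_eulerian m.+1)%:R = k%:R :> 'F_3)%R ->
    central_eulerian m.+1 = k %[mod 3].
  by move/(congr1 val); rewrite /= !val_Fp_nat.
have [c1 c0] := central_coefP _ F3 m.
split=> T; apply: modE; rewrite E.
- by apply/c1/TE.
- by apply: c0 => /TE.
Qed.
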